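(* Let $D\subset\mathbb{H}^2$ be an open horoball in the hyperbolic plane. Then there is no $\theta$-barrier for $D$, for any finite $\theta\ge0$.
   Context: $\mathbb{H}^2$ is the hyperbolic plane: the complete simply connected Riemannian 2-manifold of constant sectional curvature $-1$, with metric $\langle\cdot,\cdot\rangle$ and distance $d$. For a unit-speed geodesic ray $\gamma\colon[0,\infty)\to\mathbb{H}^2$, the Busemann function is $b_\gamma(p)=\lim_{t\to\infty}\big(d(\gamma(t),p)-t\big)$, and the associated open horoball is $b_\gamma^{-1}((-\infty,0))$. A set $D\subseteq \mathbb{H}^2$ is geodesically convex (g-convex) if for all $p,q\in D$ the geodesic segment from $p$ to $q$ lies in $D$; horoballs are g-convex. Barriers. Let $D\subseteq\mathbb{H}^2$ be open and g-convex. For a three times continuously differentiable $F\colon D\to\mathbb{R}$, let $\nabla F(p)\in T_p\mathbb{H}^2$ be the Riemannian gradient, $(\nabla^2F)_p$ the Riemannian Hessian (a symmetric bilinear form on $T_p\mathbb{H}^2$), and $(\nabla^3F)_p$ the third covariant derivative, i.e. the covariant derivative of the Hessian (a trilinear form, in general not symmetric). $F$ is strongly $1$-self-concordant if for all $p\in D$ and $u,v,w\in T_p\mathbb{H}^2$, $$|(\nabla^3F)_p(u,v,w)|\le 2\sqrt{(\nabla^2F)_p(u,u)}\sqrt{(\nabla^2F)_p(v,v)}\sqrt{(\nabla^2F)_p(w,w)},$$ and the epigraph $\{(p,t): p\in D,\ t\ge F(p)\}$ is a closed subset of $\mathbb{H}^2\times\mathbb{R}$. For a finite real number $\theta\ge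 0$, $F$ is a $\theta$-barrier for $D$ if it is strongly $1$-self-concordant, $(\nabla^2F)_p\succ0$ for all $p\in D$, and $\max_{0\neq v\in T_p\mathbb{H}^2}\frac{\langle\nabla F(p),v\rangle}{\sqrt{(\nabla^2F)_p(v,v)}}\le\sqrt\theta$ for all $p\in D$. *)

(* Defs.v *)
(* Stdlib reals with Coquelicot.

   The hyperbolic plane is realised as the upper half-plane {(x, y) | 0 < y}
   with the Riemannian metric (dx^2 + dy^2) / y^2, and its Riemannian calculus
   is written in the global chart (x, y).  Functions on (subsets of) the plane
   are total functions R -> R -> R; their values off the half-plane, or off the
   domain D under consideration, are never used. *)
From Stdlib Require Import Reals.
From Coquelicot Require Import Coquelicot.
Open Scope R_scope.

Inductive axis : Set := X | Y.

Definition vec := axis -> R.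
Definition sum2 (f : axis -> R) : R := f X + f Y.

Definition in_H2 (x y : R) : Prop := 0 < y.

(** * Riemannian structure *)

Definition metric (i j : axis) (x y : R) : R :=
  match i, j with
  | X, X | Y, Y => / y ^ 2
  | _, _ => 0
  end.

(* The inverse matrix g^{ij}. *)
Definition metric_inv (i j : axis) (x y : R) : R :=
  match i, j with
  | X, X | Y, Y => y ^ 2
  | _, _ => 0
  end.

Definition inner (x y : R) (u v : vec) : R :=
  sum2 (fun i => sum2 (fun j => metric i j x y * u i * v j)).

Definition partial (i : axis) (f : R -> R -> R) (x y : R) : R :=
  match i with
  | X => Derive (fun z => f z y) x
  | Y => Derive (fun z => f x z) y
  end.

(* Gamma^k_{ij} of the Levi-Civita connection. *)
Definition christoffel (k i j : axis) (x y : R) : R :=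
  / 2 * sum2 (fun l => metric_inv k l x y *
          (partial i (metric j l) x y + partial j (metric i l) x y
           - partial l (metric i j) x y)).

Definition grad (F : R -> R -> R) (x y : R) : vec :=
  fun i => sum2 (fun j => metric_inv i j x y * partial j F x y).

Definition hess_coef (F : R -> R -> R) (i j : axis) (x y : R) : R :=
  partial i (partial j F) x y
  - sum2 (fun k => christoffel k i j x y * partial k F x y).

Definition hess (F : R -> R -> R) (x y : R) (u v : vec) : R :=
  sum2 (fun i => sum2 (fun j => hess_coef F i j x y * u i * v j)).

(* Component (nabla_k (nabla^2 F))_{ij}: the first index is the direction of
   differentiation. *)
Definition third_coef (F : R -> R -> R) (k i j : axis) (x y : R) : R :=
  partial k (hess_coef F i j) x y
  - sum2 (fun l => christoffel l k i x y * hess_coef F l j x y)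
  - sum2 (fun l => christoffel l k j x y * hess_coef F i l x y).

Definition third (F : R -> R -> R) (x y : R) (u v w : vec) : R :=
  sum2 (fun k => sum2 (fun i => sum2 (fun j =>
    third_coef F k i j x y * u k * v i * w j))).

(** * Curves, distance and geodesic rays *)

Definition curve := axis -> R -> R.

Definition velocity (c : curve) (t : R) : vec := fun i => Derive (c i) t.

Definition speed (c : curve) (t : R) : R :=
  sqrt (inner (c X t) (c Y t) (velocity c t) (velocity c t)).

(* A C^1 curve [0,1] -> H^2.  The derivatives at the end points are two-sided:
   a C^1 map on [0,1] is the restriction of a C^1 map defined on R. *)
Definition C1_path (c : curve) (x1 y1 x2 y2 : R) : Prop :=
  (forall t, 0 <= t <= 1 ->
     in_H2 (c X t) (c Y t) /\
     forall i, ex_derive (c i) t /\ continuous (Derive (c i)) t) /\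
  (c X 0 = x1 /\ c Y 0 = y1) /\ (c X 1 = x2 /\ c Y 1 = y2).

Definition dist (x1 y1 x2 y2 : R) : R :=
  real (Glb_Rbar (fun L =>
    exists c, C1_path c x1 y1 x2 y2 /\ L = RInt (speed c) 0 1)).

(* Only the restriction of c to [0, +oo) matters; as above, the derivatives at
   the end point 0 are two-sided, which is no restriction on the ray. *)
Definition geodesic_ray (c : curve) : Prop :=
  forall t, 0 <= t ->
    in_H2 (c X t) (c Y t) /\
    (forall i, ex_derive (c i) t /\ ex_derive (Derive (c i)) t) /\
    (forall k, Derive_n (c k) 2 t
       + sum2 (fun i => sum2 (fun j =>
           christoffel k i j (c X t) (c Y t)
           * velocity c t i * velocity c t j)) = 0) /\
    speed c t = 1.

(** * Horoballs *)

Definition is_busemann (c : curve) (x y b : R) : Prop :=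
  is_lim (fun t => dist (c X t) (c Y t) x y - t) p_infty b.

Definition open_horoball (D : R -> R -> Prop) : Prop :=
  exists c, geodesic_ray c /\
    forall x y, D x y <->
      in_H2 x y /\ exists b, is_busemann c x y b /\ b < 0.

(** * Barriers *)

(* On an open set D, existence and continuity of all iterated partial
   derivatives of order at most 3. *)
Definition C3_on (D : R -> R -> Prop) (F : R -> R -> R) : Prop :=
  forall x y, D x y -> ex_diff_n F 3 x y.

(* Closedness for the topology of H^2 x R as a subspace of R^3. *)
Definition closed_epigraph (D : R -> R -> Prop) (F : R -> R -> R) : Prop :=
  exists C : R * R * R -> Prop, closed C /\
    forall x y t, in_H2 x y -> (C (x, y, t) <-> D x y /\ F x y <= t).

(* [sqrt] vanishes on negative numbers; in [barrier] the Hessian is positive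
   definite, so only square roots of nonnegative numbers occur. *)
Definition strongly_1_self_concordant
    (D : R -> R -> Prop) (F : R -> R -> R) : Prop :=
  C3_on D F /\
  (forall x y, D x y -> forall u v w : vec,
     Rabs (third F x y u v w)
     <= 2 * sqrt (hess F x y u u) * sqrt (hess F x y v v)
          * sqrt (hess F x y w w)) /\
  closed_epigraph D F.

Definition nonzero (v : vec) : Prop := exists i, v i <> 0.

Definition barrier (theta : R) (D : R -> R -> Prop) (F : R -> R -> R) : Prop :=
  strongly_1_self_concordant D F /\
  (forall x y, D x y -> forall v, nonzero v -> 0 < hess F x y v v) /\
  (forall x y, D x y -> forall v, nonzero v ->
     inner x y (grad F x y) v / sqrt (hess F x y v v) <= sqrt theta).

(* Main.v *)
(* The horoball contains the image, under a chart that sends its centre to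
   infinity, of a half-plane {y > h}.  Let f = F along a vertical unit-speed
   geodesic ray, at height t above the boundary horocycle.  Since the ray never
   leaves the domain, f'^2 <= theta f'' forces 0 <= - f' <= theta / t, and
   self-concordance then gives sqrt f'' <= - f'.  The third covariant derivative
   is not symmetric: for an orthonormal frame (u, v) with u vertical the Ricci
   identity equates the antisymmetrised third derivative with dF(u), so
   - f' <= 4 sqrt f'' Hess(v, v), hence Hess(v, v) >= 1/4.  Along a horocycle
   g'' = Hess(v, v) + dF(u), which for t large is at least Hess(v, v) / 2, hence
   at least 1/8 and at least g'^2 / (2 theta).  Such a g blows up in finite time,
   whereas horocycles are complete. *)
Require Import Defs.
From Stdlib Require Import Reals Lra Psatz Classical.
From Coquelicot Require Import Coquelicot.
Open Scope R_scope.

(** * Partial derivatives and the Ricci identity *)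

Lemma locally_2d_idem (P : R -> R -> Prop) (x y : R) :
  locally_2d P x y -> locally_2d (locally_2d P) x y.
Proof.
  intros H. apply locally_2d_locally in H. apply locally_2d_locally.
  apply locally_locally in H. revert H. apply filter_imp.
  intros [u v] H. apply locally_2d_locally. exact H.
Qed.

Lemma partial_diff (i : axis) (G : R -> R -> R) (n : nat) (x y : R) :
  ex_diff_n G (S n) x y -> ex_diff_n (partial i G) n x y.
Proof. intros [_ [_ [_ [H1 H2]]]]. destruct i; assumption. Qed.

Lemma partial_diff_loc (i : axis) (G : R -> R -> R) (n : nat) (x y : R) :
  locally_2d (ex_diff_n G (S n)) x y -> locally_2d (ex_diff_n (partial i G) n) x y.
Proof. apply locally_2d_impl, locally_2d_forall. intros u v. apply partial_diff. Qed.

Lemma ex_diff_loc_le (G : R -> R -> R) (n m : nat) (x y : R) : (m <= n)%nat ->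
  locally_2d (ex_diff_n G n) x y -> locally_2d (ex_diff_n G m) x y.
Proof.
  intros Hm. apply locally_2d_impl, locally_2d_forall. intros u v.
  now apply ex_diff_n_m.
Qed.

Lemma ex_diff_is_derive_x (G : R -> R -> R) (n : nat) (x y : R) :
  ex_diff_n G (S n) x y -> is_derive (fun z => G z y) x (partial X G x y).
Proof. intros [_ [H _]]. apply Derive_correct, H. Qed.

Lemma ex_diff_is_derive_y (G : R -> R -> R) (n : nat) (x y : R) :
  ex_diff_n G (S n) x y -> is_derive (fun z => G x z) y (partial Y G x y).
Proof. intros [_ [_ [H _]]]. apply Derive_correct, H. Qed.

Lemma partial_comm (G : R -> R -> R) (x y : R) :
  locally_2d (ex_diff_n G 2) x y ->
  partial X (partial Y G) x y = partial Y (partial X G) x y.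
Proof.
  intros H. unfold partial. apply Schwarz.
  - revert H. apply locally_2d_impl, locally_2d_forall.
    intros u v [_ [H1 [H2 [H3 H4]]]].
    split; [exact H1|split; [exact H2|split]].
    + apply H4.
    + apply H3.
  - apply locally_2d_singleton in H. destruct H as [_ [_ [_ [_ H]]]]. apply H.
  - apply locally_2d_singleton in H. destruct H as [_ [_ [_ [H _]]]]. apply H.
Qed.

Lemma is_derive_along_curve (G : R -> R -> R) (p q : R -> R) (t p1 q1 : R) :
  locally_2d (ex_diff_n G 1) (p t) (q t) ->
  is_derive p t p1 -> is_derive q t q1 ->
  is_derive (fun s => G (p s) (q s)) t
    (partial X G (p t) (q t) * p1 + partial Y G (p t) (q t) * q1).
Proof.
  intros HG Hp Hq. apply is_derive_Reals.
  apply derivable_pt_lim_comp_2d; [|now apply is_derive_Reals..].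
  apply filterdiff_differentiable_pt_lim.
  apply is_derive_filterdiff.
  - apply locally_2d_locally in HG. revert HG. apply filter_imp.
    intros u H. apply (ex_diff_is_derive_x G 0), H.
  - apply locally_2d_singleton in HG. apply (ex_diff_is_derive_y G 0), HG.
  - apply locally_2d_singleton in HG. destruct HG as [_ [_ [_ [[H _] _]]]].
    apply continuity_2d_pt_filterlim in H. exact H.
Qed.

Lemma locally_2d_pos (x y : R) : 0 < y -> locally_2d (fun _ v => 0 < v) x y.
Proof.
  intros Hy. exists (mkposreal y Hy). simpl. intros u v _ Hv.
  apply Rabs_def2 in Hv. lra.
Qed.

(** * Christoffel symbols, gradient and Hessian in the half-plane chart *)

Lemma christoffel_eq (k i j : axis) (x y : R) : 0 < y ->
  christoffel k i j x y =
  match k, i, j with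
  | X, X, Y | X, Y, X | Y, Y, Y => - / y
  | Y, X, X => / y
  | _, _, _ => 0
  end.
Proof.
  intros Hy.
  assert (E : Derive (fun z => / z ^ 2) y = - 2 / y ^ 3).
  { apply is_derive_unique. auto_derive; [nra|field; lra]. }
  unfold christoffel, sum2, partial.
  destruct k, i, j; unfold metric, metric_inv; rewrite ?Derive_const, ?E;
    field; lra.
Qed.

(* For each (i, j) the only nonzero [- christoffel k i j] is
   [conn_sign i j / y], at k = [conn_dir i j]. *)
Definition conn_dir (i j : axis) : axis :=
  match i, j with X, X | Y, Y => Y | _, _ => X end.

Definition conn_sign (i j : axis) : R :=
  match i, j with X, X => -1 | _, _ => 1 end.

Lemma hess_coef_eq (F : R -> R -> R) (i j : axis) (x y : R) : 0 < y ->
  hess_coef F i j x y =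
  partial i (partial j F) x y + conn_sign i j * (partial (conn_dir i j) F x y / y).
Proof.
  intros Hy. unfold hess_coef, sum2.
  destruct i, j; rewrite !christoffel_eq by assumption; unfold conn_dir, conn_sign;
    field; lra.
Qed.

Lemma inner_grad (F : R -> R -> R) (x y : R) (v : vec) : 0 < y ->
  inner x y (grad F x y) v = partial X F x y * v X + partial Y F x y * v Y.
Proof. intros Hy. unfold inner, grad, sum2, metric, metric_inv. field. lra. Qed.

Lemma hess_eq (F : R -> R -> R) (x y : R) (v : vec) : 0 < y ->
  hess F x y v v =
  (partial X (partial X F) x y - partial Y F x y / y) * v X ^ 2 +
  (partial X (partial Y F) x y + partial Y (partial X F) x y
     + 2 * partial X F x y / y) * v X * v Y +
  (partial Y (partial Y F) x y + partial Y F x y / y) * v Y ^ 2.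
Proof.
  intros Hy. unfold hess, sum2. rewrite !hess_coef_eq by assumption.
  unfold conn_dir, conn_sign. field. lra.
Qed.

Lemma is_derive_add_scal (f g : R -> R) (c t f1 g1 : R) :
  is_derive f t f1 -> is_derive g t g1 ->
  is_derive (fun s => f s + c * g s) t (f1 + c * g1).
Proof.
  intros Hf Hg. apply (is_derive_plus f (fun s => c * g s)); [exact Hf|].
  now apply (is_derive_scal g).
Qed.

Lemma is_derive_quot (f g : R -> R) (t f1 g1 : R) : g t <> 0 ->
  is_derive f t f1 -> is_derive g t g1 ->
  is_derive (fun s => f s / g s) t (f1 / g t - f t * g1 / g t ^ 2).
Proof.
  intros Hn Hf Hg.
  replace (f1 / g t - f t * g1 / g t ^ 2) with ((f1 * g t - f t * g1) / g t ^ 2)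
    by (field; exact Hn).
  now apply (is_derive_div f g).
Qed.

Lemma partial_hess_coef (F : R -> R -> R) (k i j : axis) (x y : R) : 0 < y ->
  ex_diff_n F 3 x y ->
  partial k (hess_coef F i j) x y =
  partial k (partial i (partial j F)) x y + conn_sign i j *
    (partial k (partial (conn_dir i j) F) x y / y -
     partial (conn_dir i j) F x y * (match k with X => 0 | Y => 1 end) / y ^ 2).
Proof.
  intros Hy HF.
  assert (H1 : forall i, ex_diff_n (partial i F) 2 x y)
    by (intros; now apply partial_diff).
  assert (H2 : forall i j, ex_diff_n (partial i (partial j F)) 1 x y)
    by (intros; now apply partial_diff).
  destruct k; apply is_derive_unique.
  - eapply is_derive_ext.
    { intros z. symmetry. apply hess_coef_eq, Hy. }
    apply (is_derive_add_scal (fun z => partial i (partial j F) z y)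
      (fun z => partial (conn_dir i j) F z y / y)).
    + apply (ex_diff_is_derive_x _ 0), H2.
    + apply (is_derive_quot (fun z => partial (conn_dir i j) F z y) (fun _ => y)).
      * lra.
      * apply (ex_diff_is_derive_x _ 1), H1.
      * apply (is_derive_const y).
  - eapply is_derive_ext_loc.
    { exists (mkposreal y Hy). intros z Hz. symmetry. apply hess_coef_eq.
      apply Rabs_def2 in Hz. unfold minus, plus, opp in Hz; simpl in Hz. lra. }
    apply (is_derive_add_scal (fun z => partial i (partial j F) x z)
      (fun z => partial (conn_dir i j) F x z / z)).
    + apply (ex_diff_is_derive_y _ 0), H2.
    + apply (is_derive_quot (fun z => partial (conn_dir i j) F x z) (fun z => z)).
      * lra.
      * apply (ex_diff_is_derive_y _ 1), H1.
      * apply (is_derive_id y).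
Qed.

(* The Ricci identity: curvature -1 turns the antisymmetrisation of the third
   covariant derivative into the gradient. *)
Lemma third_swap (F : R -> R -> R) (x y : R) (u v : vec) : 0 < y ->
  locally_2d (ex_diff_n F 3) x y ->
  u X ^ 2 + u Y ^ 2 = y ^ 2 -> v X = - u Y -> v Y = u X ->
  third F x y u v v - third F x y v u v =
  partial X F x y * u X + partial Y F x y * u Y.
Proof.
  intros Hy HF Hu Hv1 Hv2.
  assert (HF' := locally_2d_singleton _ _ _ HF).
  assert (E0 : partial X (partial Y F) x y = partial Y (partial X F) x y)
    by (apply partial_comm; revert HF; apply ex_diff_loc_le; auto).
  (* Third partials are reordered in two ways: [E1] swaps the outer two derivatives, [E2] the inner
     two. *)
  assert (E1 : forall i, partial X (partial Y (partial i F)) x y =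
                         partial Y (partial X (partial i F)) x y).
  { intros i. apply partial_comm, partial_diff_loc, HF. }
  assert (E2 : forall i, partial i (partial X (partial Y F)) x y =
                         partial i (partial Y (partial X F)) x y).
  { intros i.
    assert (HL : locally_2d (fun a b => partial X (partial Y F) a b =
                                        partial Y (partial X F) a b) x y).
    { apply locally_2d_idem in HF. revert HF. apply locally_2d_impl, locally_2d_forall.
      intros a b H. apply partial_comm. revert H. apply ex_diff_loc_le; auto. }
    destruct i; apply Derive_ext_loc.
    - exact (locally_2d_1d_const_y _ _ _ HL).
    - exact (locally_2d_1d_const_x _ _ _ HL). }
  unfold third, third_coef, sum2.
  rewrite !christoffel_eq, !partial_hess_coef, !hess_coef_eq by assumption.
  unfold conn_dir, conn_sign. rewrite ?(E1 Y), ?(E2 X), ?(E2 Y), ?(E1 X), ?E0, Hv1, Hv2.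
  set (a := u X) in *. set (b := u Y) in *.
  (* Curvature contributes dF(u) times the squared norm of [u], which is 1. *)
  transitivity ((a ^ 2 + b ^ 2) / y ^ 2 * (partial X F x y * a + partial Y F x y * b)).
  - field. lra.
  - rewrite Hu. field. lra.
Qed.

(** * Differential inequalities *)

Lemma derive_nonneg_le (f df : R -> R) (a b : R) : a <= b ->
  (forall s, a <= s <= b -> is_derive f s (df s)) ->
  (forall s, a <= s <= b -> 0 <= df s) -> f a <= f b.
Proof.
  intros Hab Hf Hdf.
  destruct (MVT_gen f a b df) as [c [Hc E]];
    rewrite ?Rmin_left, ?Rmax_right in * by assumption.
  - intros s Hs. apply Hf. lra.
  - intros s Hs. apply continuity_pt_filterlim, (ex_derive_continuous f).
    exists (df s). now apply Hf.
  - specialize (Hdf c Hc). nra.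
Qed.

(** Where [f] does not vanish, (1/f)' = - f'/f^2 <= - c; integrate. The sign of [f] is left free, as
    both positive and negative solutions occur. *)
Lemma riccati_inv_le (f df : R -> R) (c a b : R) : a <= b ->
  (forall s, a <= s <= b -> is_derive f s (df s)) ->
  (forall s, a <= s <= b -> f s <> 0) ->
  (forall s, a <= s <= b -> c * f s ^ 2 <= df s) ->
  / f b + c * (b - a) <= / f a.
Proof.
  intros Hab Hf H0 Hdf.
  assert (- / f a - c * a <= - / f b - c * b); [|lra].
  apply (derive_nonneg_le (fun s => - / f s - c * s) (fun s => df s / f s ^ 2 - c));
    [exact Hab| |].
  - intros s Hs. specialize (H0 s Hs). specialize (Hf s Hs).
    auto_derive.
    + split; [now exists (df s)|easy].
    + replace (Derive _ _) with (df s) by (symmetry; apply is_derive_unique, Hf). field. exact H0.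
  - intros s Hs. specialize (Hdf s Hs). specialize (H0 s Hs).
    assert (0 < f s ^ 2) by (apply pow2_gt_0, H0).
    apply Rmult_le_reg_r with (f s ^ 2); [assumption|].
    field_simplify; [nra|exact H0].
Qed.

(** A positive value persists since [f] is nondecreasing; then 1/f falls at rate at least [c] and
    would reach 0 in finite time. *)
Lemma riccati_blow_up (f df : R -> R) (c a : R) : 0 < c ->
  (forall s, a <= s -> is_derive f s (df s)) ->
  (forall s, a <= s -> c * f s ^ 2 <= df s) ->
  f a <= 0.
Proof.
  intros Hc Hf Hdf. destruct (Rle_lt_dec (f a) 0) as [H|H]; [exact H|exfalso].
  assert (Hpos : forall s, a <= s -> 0 < f s).
  { intros s Hs. apply Rlt_le_trans with (f a); [exact H|].
    apply (derive_nonneg_le f df); [exact Hs|intros; apply Hf; lra|].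
    intros r Hr. specialize (Hdf r (proj1 Hr)). pose proof (pow2_ge_0 (f r)). nra. }
  (* By this time the upper bound on 1/f has dropped to 0. *)
  set (b := a + / (c * f a)).
  assert (Hca : 0 < / (c * f a)) by (apply Rinv_0_lt_compat; nra).
  assert (Hab : a <= b) by (unfold b; lra).
  assert (E := riccati_inv_le f df c a b Hab).
  assert (Hb := Rinv_0_lt_compat _ (Hpos b Hab)).
  assert (c * (b - a) = / f a) by (unfold b; field; lra).
  assert (/ f b + c * (b - a) <= / f a); [|lra].
  apply E.
  - intros s Hs. apply Hf. lra.
  - intros s Hs. specialize (Hpos s (proj1 Hs)). lra.
  - intros s Hs. apply Hdf. lra.
Qed.

(* [f1], [f2], [f3] play the role of the first three derivatives, along an
   infinite geodesic ray, of a self-concordant barrier. *)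
Lemma barrier_ray_decay (f1 f2 f3 : R -> R) (theta : R) : 0 < theta ->
  (forall t, 0 < t -> is_derive f1 t (f2 t)) ->
  (forall t, 0 < t -> is_derive f2 t (f3 t)) ->
  (forall t, 0 < t -> 0 < f2 t) ->
  (forall t, 0 < t -> f1 t ^ 2 <= theta * f2 t) ->
  (forall t, 0 < t -> Rabs (f3 t) <= 2 * f2 t * sqrt (f2 t)) ->
  forall t, 0 < t -> - f1 t <= theta / t /\ sqrt (f2 t) <= - f1 t.
Proof.
  intros Hth H1 H2 Hpos Hbar Hsc.
  assert (Hth' := Rinv_0_lt_compat _ Hth).
  assert (Hric : forall t, 0 < t -> / theta * f1 t ^ 2 <= f2 t).
  { intros t Ht. specialize (Hbar t Ht).
    apply Rmult_le_reg_l with theta; [exact Hth|].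
    rewrite <- Rmult_assoc, Rinv_r, Rmult_1_l by lra. exact Hbar. }
  assert (Hle : forall t, 0 < t -> f1 t <= 0).
  { intros t Ht. apply (riccati_blow_up f1 f2 (/ theta)); [exact Hth'| |].
    - intros s Hs. apply H1. lra.
    - intros s Hs. apply Hric. lra. }
  (* As [f2] is positive, [f1] is strictly increasing, so [f1 t < f1 (t + 1) <= 0]. *)
  assert (Hlt : forall t, 0 < t -> f1 t < 0).
  { intros t Ht. apply Rlt_le_trans with (f1 (t + 1)); [|apply Hle; lra].
    apply (incr_function_le f1 t (t + 1) f2); simpl; try lra.
    - intros s Hs _. apply H1. lra.
    - intros s Hs _. apply Hpos. lra. }
  intros t Ht. split.
  (* Integrate the Riccati inequality up to [t]. The data live on positive times, hence the start at
     [e / 2], where [e / theta] is the supposed gap; the outcome is e/theta < e/(2 theta). *)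
  - assert (Hinv : t / theta <= / (- f1 t)).
    { apply Rnot_lt_le. intros Hn.
      set (e := (t / theta - / (- f1 t)) * theta).
      assert (Hip : 0 < / (- f1 t)) by (apply Rinv_0_lt_compat; specialize (Hlt t Ht); lra).
      assert (He : 0 < e) by (unfold e; nra).
      assert (Het : e = t - theta * / (- f1 t)) by (unfold e; field; specialize (Hlt t Ht); lra).
      assert (Hs : 0 < e / 2 <= t) by nra.
      assert (E : / f1 t + / theta * (t - e / 2) <= / f1 (e / 2)).
      { apply (riccati_inv_le f1 f2); [lra|..]; intros r Hr.
        - apply H1; lra.
        - specialize (Hlt r); lra.
        - apply Hric; lra. }
      assert (/ f1 (e / 2) < 0) by (apply Rinv_lt_0_compat, Hlt; lra).
      assert (/ f1 t = - / (- f1 t)) by (field; specialize (Hlt t Ht); lra).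
      assert (/ theta * e = / theta * t - / (- f1 t))
        by (rewrite Het; field; specialize (Hlt t Ht); lra).
      nra. }
    specialize (Hlt t Ht).
    apply Rmult_le_reg_r with (t / theta * / (- f1 t)).
    + apply Rmult_lt_0_compat; [apply Rdiv_lt_0_compat; lra|apply Rinv_0_lt_compat; lra].
    + replace (- f1 t * (t / theta * / - f1 t)) with (t / theta) by (field; lra).
      replace (theta / t * (t / theta * / - f1 t)) with (/ - f1 t) by (field; lra).
      exact Hinv.
  (* Self-concordance makes [r] 1-Lipschitz, so [f2 s] is at least 1/(r t + (s - t))^2. Integrating
     from [t] and using [f1 s <= 0] bounds [f1 t + sqrt (f2 t)] by a quantity tending to 0. *)
  - set (r := fun s => / sqrt (f2 s)).
    assert (Hsq : forall s, 0 < s -> 0 < sqrt (f2 s))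
      by (intros; apply sqrt_lt_R0; auto).
    assert (Hr : forall s, 0 < s -> 0 < r s)
      by (intros; apply Rinv_0_lt_compat; auto).
    assert (Hrt : forall s, t <= s -> r s <= r t + (s - t)).
    { intros s Hs.
      assert (t - r t <= s - r s); [|lra].
      apply (derive_nonneg_le (fun s => s - r s)
        (fun s => 1 + f3 s / (2 * f2 s * sqrt (f2 s)))); [exact Hs| |]; intros u Hu;
        assert (Hu0 : 0 < u) by lra;
        specialize (H2 u Hu0); specialize (Hpos u Hu0); specialize (Hsq u Hu0).
      - unfold r. auto_derive.
        + repeat split; [now exists (f3 u)|exact Hpos|lra].
        + replace (Derive _ _) with (f3 u) by (symmetry; apply is_derive_unique, H2).
          replace (2 * f2 u * sqrt (f2 u)) with (2 * (sqrt (f2 u) * sqrt (f2 u)) * sqrt (f2 u))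
            by (rewrite sqrt_sqrt; lra).
          field. lra.
      - specialize (Hsc u Hu0). apply Rabs_le_between in Hsc.
        assert (0 < 2 * f2 u * sqrt (f2 u)) by nra.
        apply Rmult_le_reg_r with (2 * f2 u * sqrt (f2 u)); [assumption|].
        set (w := 2 * f2 u * sqrt (f2 u)) in *.
        replace ((1 + f3 u / w) * w) with (w + f3 u) by (field; lra). lra. }
    assert (Hrt0 := Hr t Ht).
    assert (HK : forall s, t <= s -> f1 t + / r t <= / (r t + (s - t))).
    { intros s Hs.
      assert (E : f1 t + / (r t + (t - t)) <= f1 s + / (r t + (s - t))).
      { apply (derive_nonneg_le (fun s => f1 s + / (r t + (s - t)))
          (fun s => f2 s - / (r t + (s - t)) ^ 2)); [exact Hs| |]; intros u Hu;
          assert (Hu0 : 0 < u) by lra.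
        - specialize (H1 u Hu0). auto_derive.
          + split; [now exists (f2 u)|split; [lra|easy]].
          + replace (Derive _ _) with (f2 u) by (symmetry; apply is_derive_unique, H1). field. lra.
        - assert (Hle2 : / (r t + (u - t)) <= sqrt (f2 u)).
          { rewrite <- (Rinv_inv (sqrt (f2 u))). apply Rinv_le_contravar.
            - apply Hr, Hu0.
            - apply Hrt. lra. }
          assert (0 < / (r t + (u - t))) by (apply Rinv_0_lt_compat; lra).
          rewrite <- (sqrt_sqrt (f2 u)) by (specialize (Hpos u Hu0); lra).
          rewrite <- pow_inv. nra. }
      rewrite Rminus_diag, Rplus_0_r in E. specialize (Hle s). lra. }
    unfold r in HK at 1. rewrite Rinv_inv in HK.
    assert (f1 t + sqrt (f2 t) <= 0); [|lra].
    apply Rnot_lt_le. intros Hn. set (e := f1 t + sqrt (f2 t)) in *.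
    assert (He := Rinv_0_lt_compat _ Hn).
    (* At this time the bound is already below [e]. *)
    specialize (HK (t + / e)).
    assert (/ (r t + (t + / e - t)) < / (/ e)) by (apply Rinv_lt_contravar; nra).
    rewrite Rinv_inv in H. lra.
Qed.

(** The slope bound [m] makes [f] positive at a late enough time, and from there it blows up. *)
Lemma no_global_riccati (f df : R -> R) (c m : R) : 0 < c -> 0 < m ->
  (forall s, is_derive f s (df s)) ->
  (forall s, c * f s ^ 2 <= df s) -> (forall s, m <= df s) -> False.
Proof.
  intros Hc Hm Hf Hric Hlow.
  set (b := (Rabs (f 0) + 1) / m).
  assert (Hb : 0 <= b).
  { apply Rdiv_le_0_compat; [|exact Hm]. pose proof (Rabs_pos (f 0)). lra. }
  assert (E : f 0 - m * 0 <= f b - m * b).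
  { apply (derive_nonneg_le (fun s => f s - m * s) (fun s => df s - m)); [exact Hb| |].
    - intros s _. auto_derive.
      + now exists (df s).
      + replace (Derive _ _) with (df s) by (symmetry; apply is_derive_unique, (Hf s)). ring.
    - intros s _. specialize (Hlow s). lra. }
  assert (Hmb : m * b = Rabs (f 0) + 1) by (unfold b; field; lra).
  assert (f b <= 0) by (apply (riccati_blow_up f df c); auto).
  pose proof (Rle_abs (- f 0)). rewrite Rabs_Ropp in H0. lra.
Qed.

(** * Barriers along geodesics and horocycles *)

Definition pair_vec (a b : R) : vec := fun i => match i with X => a | Y => b end.

Definition differential (F : R -> R -> R) (x y : R) (v : vec) : R :=
  partial X F x y * v X + partial Y F x y * v Y.

(** Leibniz rule for the Levi-Civita connection. The last [pair_vec] is the covariant acceleration: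
    [(a1, b1)] corrected by the Christoffel symbols. *)
Lemma is_derive_differential (F : R -> R -> R) (p q a b : R -> R) (t a1 b1 : R) :
  0 < q t -> locally_2d (ex_diff_n F 3) (p t) (q t) ->
  is_derive p t (a t) -> is_derive q t (b t) ->
  is_derive a t a1 -> is_derive b t b1 ->
  is_derive (fun s => differential F (p s) (q s) (pair_vec (a s) (b s))) t
    (hess F (p t) (q t) (pair_vec (a t) (b t)) (pair_vec (a t) (b t)) +
     differential F (p t) (q t)
       (pair_vec (a1 - 2 * a t * b t / q t) (b1 + (a t ^ 2 - b t ^ 2) / q t))).
Proof.
  intros Hq HF Hp' Hq' Ha Hb.
  assert (HG : forall i, is_derive (fun s => partial i F (p s) (q s)) t
    (partial X (partial i F) (p t) (q t) * a t + partial Y (partial i F) (p t) (q t) * b t)).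
  { intros i. apply is_derive_along_curve; [|assumption..].
    apply (ex_diff_loc_le _ 2); [auto|]. now apply partial_diff_loc. }
  unfold differential, pair_vec. evar_last.
  - apply (is_derive_plus (fun s => partial X F (p s) (q s) * a s)
      (fun s => partial Y F (p s) (q s) * b s)).
    + apply (is_derive_mult (fun s => partial X F (p s) (q s)) a);
        [apply HG|exact Ha|exact Rmult_comm].
    + apply (is_derive_mult (fun s => partial Y F (p s) (q s)) b);
        [apply HG|exact Hb|exact Rmult_comm].
  - rewrite hess_eq by exact Hq. unfold plus, mult; simpl. field. lra.
Qed.

(** The conditions on [a] and [b] are the geodesic equation, so the velocity is parallel and only
    the covariant derivative of the Hessian survives. *)
Lemma is_derive_hess_geodesic (F : R -> R -> R) (p q a b : R -> R) (t : R) :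
  locally t (fun s => 0 < q s) -> locally_2d (ex_diff_n F 3) (p t) (q t) ->
  is_derive p t (a t) -> is_derive q t (b t) ->
  is_derive a t (2 * a t * b t / q t) ->
  is_derive b t ((b t ^ 2 - a t ^ 2) / q t) ->
  is_derive
    (fun s => hess F (p s) (q s) (pair_vec (a s) (b s)) (pair_vec (a s) (b s))) t
    (third F (p t) (q t) (pair_vec (a t) (b t)) (pair_vec (a t) (b t))
       (pair_vec (a t) (b t))).
Proof.
  intros Hloc HF Hp' Hq' Ha Hb.
  assert (Hq := locally_singleton _ _ Hloc).
  assert (HF0 := locally_2d_singleton _ _ _ HF).
  assert (HG : forall i, is_derive (fun s => partial i F (p s) (q s)) t
    (partial X (partial i F) (p t) (q t) * a t + partial Y (partial i F) (p t) (q t) * b t)).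
  { intros i. apply is_derive_along_curve; [|assumption..].
    apply (ex_diff_loc_le _ 2); [auto|]. now apply partial_diff_loc. }
  assert (HGG : forall i j, is_derive (fun s => partial i (partial j F) (p s) (q s)) t
    (partial X (partial i (partial j F)) (p t) (q t) * a t +
     partial Y (partial i (partial j F)) (p t) (q t) * b t)).
  { intros i j. apply is_derive_along_curve; [|assumption..].
    now do 2 apply partial_diff_loc. }
  assert (HH : forall i j, is_derive (fun s => hess_coef F i j (p s) (q s)) t
    (partial X (hess_coef F i j) (p t) (q t) * a t +
     partial Y (hess_coef F i j) (p t) (q t) * b t)).
  { intros i j.
    apply (is_derive_ext_loc (fun s => partial i (partial j F) (p s) (q s) +
      conn_sign i j * (partial (conn_dir i j) F (p s) (q s) / q s))).
    { revert Hloc. apply filter_imp. intros s Hs. symmetry. apply hess_coef_eq, Hs. }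
    evar_last.
    - apply (is_derive_add_scal (fun s => partial i (partial j F) (p s) (q s))
        (fun s => partial (conn_dir i j) F (p s) (q s) / q s)); [apply HGG|].
      apply (is_derive_quot (fun s => partial (conn_dir i j) F (p s) (q s)) q);
        [lra|apply HG|exact Hq'].
    - cbv beta. rewrite !partial_hess_coef by assumption. field. lra. }
  unfold hess, third, sum2, pair_vec. evar_last.
  - assert (HM : forall (c f g : R -> R) c1 f1 g1, is_derive c t c1 ->
      is_derive f t f1 -> is_derive g t g1 ->
      is_derive (fun s => c s * f s * g s) t
        (c1 * f t * g t + c t * f1 * g t + c t * f t * g1)).
    { intros c f g c1 f1 g1 Hc Hf Hg. evar_last.
      - apply (is_derive_mult (fun s => c s * f s) g); [|exact Hg|exact Rmult_comm].
        apply (is_derive_mult c f); [exact Hc|exact Hf|exact Rmult_comm].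
      - unfold plus, mult; simpl. ring. }
    assert (HP : forall (f g : R -> R) f1 g1,
      is_derive f t f1 -> is_derive g t g1 ->
      is_derive (fun s => f s + g s) t (f1 + g1))
      by (intros; now apply (is_derive_plus f g)).
    apply (HP (fun s => _ + _) (fun s => _ + _)); apply HP; apply HM; eauto.
  - unfold third_coef, sum2. rewrite !christoffel_eq by exact Hq. field. lra.
Qed.

(** The barrier bound is one-sided; applied to [v] and [- v], which share their Hessian value, it
    bounds |dF(v)|. *)
Lemma barrier_differential (theta : R) (D : R -> R -> Prop) (F : R -> R -> R)
  (x y : R) (v : vec) : 0 <= theta -> barrier theta D F -> D x y -> 0 < y ->
  Defs.nonzero v -> differential F x y v ^ 2 <= theta * hess F x y v v.
Proof.
  intros Hth [_ [Hpos Hgrad]] HD Hy Hv.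
  set (h := hess F x y v v).
  assert (Hh : 0 < h) by (apply Hpos; assumption).
  assert (Hs := sqrt_lt_R0 _ Hh).
  assert (Hle : forall w, Defs.nonzero w -> hess F x y w w = h ->
    differential F x y w <= sqrt theta * sqrt h).
  { intros w Hw Ew. specialize (Hgrad x y HD w Hw).
    rewrite inner_grad, Ew in Hgrad by exact Hy. fold (differential F x y w) in Hgrad.
    apply (Rmult_le_compat_r (sqrt h)) in Hgrad; [|lra].
    unfold Rdiv in Hgrad. rewrite Rmult_assoc, Rinv_l, Rmult_1_r in Hgrad by lra.
    exact Hgrad. }
  assert (H1 := Hle v Hv eq_refl).
  assert (H2 : differential F x y (fun i => - v i) <= sqrt theta * sqrt h).
  { apply Hle.
    - destruct Hv as [i Hi]. exists i. lra.
    - unfold h. rewrite !hess_eq by exact Hy. ring. }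
  replace (differential F x y (fun i => - v i)) with (- differential F x y v) in H2
    by (unfold differential; ring).
  rewrite <- (sqrt_sqrt theta), <- (sqrt_sqrt h) by lra.
  assert (0 <= sqrt theta * sqrt h) by (apply Rmult_le_pos; [apply sqrt_pos|lra]).
  nra.
Qed.

(* [P], [Q] are coordinates in which the lines [s] = const are unit-speed
   geodesics with velocity [(A, B)], and the line [t = t0] is a horocycle
   centred at their common end point; the latter is traversed with velocity
   [(- B, A)] and has covariant acceleration [(A, B)]. *)
Definition horocyclic_coords (t0 : R) (P Q A B : R -> R -> R) : Prop :=
  (forall s t, 0 < Q s t /\ A s t ^ 2 + B s t ^ 2 = Q s t ^ 2) /\
  (forall s t, is_derive (P s) t (A s t) /\ is_derive (Q s) t (B s t) /\
     is_derive (A s) t (2 * A s t * B s t / Q s t) /\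
     is_derive (B s) t ((B s t ^ 2 - A s t ^ 2) / Q s t)) /\
  (forall s, is_derive (fun s => P s t0) s (- B s t0) /\
     is_derive (fun s => Q s t0) s (A s t0) /\
     is_derive (fun s => - B s t0) s (2 * (- B s t0) * A s t0 / Q s t0 + A s t0) /\
     is_derive (fun s => A s t0) s ((A s t0 ^ 2 - B s t0 ^ 2) / Q s t0 + B s t0)).

(** [S] is the open set supplying neighbourhoods on which [F] is C^3. The condition on [t0] gives -
    dF(u) <= 1/8 on the horocycle. *)
Lemma no_barrier_horocyclic_coords (theta t0 : R) (D S : R -> R -> Prop)
  (F P Q A B : R -> R -> R) :
  0 < theta -> 0 < t0 -> theta / t0 <= / 8 ->
  (forall x y, S x y -> locally_2d S x y) -> (forall x y, S x y -> D x y) ->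
  horocyclic_coords t0 P Q A B ->
  (forall s t, 0 < t -> S (P s t) (Q s t)) ->
  ~ barrier theta D F.
Proof.
  intros Hth Ht0 Hsmall Hopen HSD [HQ [Hgeo Hhor]] HS HB.
  assert (HB' := HB). destruct HB' as [[HC3 [Hsc _]] [Hpos _]].
  assert (HF : forall s t, 0 < t -> locally_2d (ex_diff_n F 3) (P s t) (Q s t)).
  { intros s t Ht. generalize (Hopen _ _ (HS s t Ht)).
    apply locally_2d_impl, locally_2d_forall. intros; now apply HC3, HSD. }
  assert (HD : forall s t, 0 < t -> D (P s t) (Q s t)) by (intros; now apply HSD, HS).
  set (u := fun s t => pair_vec (A s t) (B s t)).
  set (v := fun s t => pair_vec (- B s t) (A s t)).
  assert (Hu : forall s t, Defs.nonzero (u s t)).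
  { intros s t. destruct (HQ s t) as [H1 H2].
    destruct (Req_dec (A s t) 0) as [E|E].
    - exists Y. simpl. intros E'. rewrite E, E' in H2. nra.
    - exists X. exact E. }
  assert (Hv : forall s t, Defs.nonzero (v s t)).
  { intros s t. destruct (Hu s t) as [[|] E]; simpl in E.
    - exists Y. exact E.
    - exists X. simpl. lra. }
  assert (Hray : forall s t, 0 < t ->
    - differential F (P s t) (Q s t) (u s t) <= theta / t /\
    sqrt (hess F (P s t) (Q s t) (u s t) (u s t)) <=
      - differential F (P s t) (Q s t) (u s t)).
  { intros s.
    apply (barrier_ray_decay (fun t => differential F (P s t) (Q s t) (u s t))
      (fun t => hess F (P s t) (Q s t) (u s t) (u s t))
      (fun t => third F (P s t) (Q s t) (u s t) (u s t) (u s t)));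
      [exact Hth|intros t Ht; destruct (Hgeo s t) as [G1 [G2 [G3 G4]]]; destruct (HQ s t) as [Q1 Q2]..].
    - evar_last.
      + apply (is_derive_differential F (P s) (Q s) (A s) (B s)); eauto.
      + fold (u s t). unfold differential, pair_vec. field. lra.
    - apply (is_derive_hess_geodesic F (P s) (Q s) (A s) (B s)); auto.
      exists (mkposreal 1 Rlt_0_1). intros r _. apply HQ.
    - apply Hpos; auto.
    - apply barrier_differential with D; auto. lra.
    - eapply Rle_trans; [apply Hsc; auto|].
      specialize (Hpos _ _ (HD s t Ht) _ (Hu s t)).
      rewrite !Rmult_assoc, (sqrt_sqrt (hess _ _ _ _ _)) by lra. lra. }
  assert (Hlow : forall s, / 4 <= hess F (P s t0) (Q s t0) (v s t0) (v s t0)).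
  { intros s. destruct (Hray s t0 Ht0) as [_ Hsq].
    destruct (HQ s t0) as [Q1 Q2].
    assert (E := third_swap F _ _ (u s t0) (v s t0) Q1 (HF s t0 Ht0) Q2 eq_refl eq_refl).
    fold (differential F (P s t0) (Q s t0) (u s t0)) in E.
    assert (S1 := Hsc _ _ (HD s t0 Ht0) (u s t0) (v s t0) (v s t0)).
    assert (S2 := Hsc _ _ (HD s t0 Ht0) (v s t0) (u s t0) (v s t0)).
    assert (Pu := Hpos _ _ (HD s t0 Ht0) _ (Hu s t0)).
    assert (Pv := Hpos _ _ (HD s t0 Ht0) _ (Hv s t0)).
    set (hu := hess F _ _ (u s t0) (u s t0)) in *.
    set (hv := hess F _ _ (v s t0) (v s t0)) in *.
    set (g := differential F _ _ _) in *.
    assert (Ev := sqrt_sqrt hv (Rlt_le _ _ Pv)).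
    assert (Hsu := sqrt_lt_R0 _ Pu).
    apply Rabs_le_between in S1. apply Rabs_le_between in S2.
    (* The Ricci identity with both self-concordance bounds. Then [sqrt hu <= - g] allows division
       by the positive number [- g]. *)
    assert (- g <= 4 * sqrt hu * hv) by (rewrite <- Ev; lra).
    assert (- g <= 4 * (- g) * hv) by nra.
    nra. }
  apply (no_global_riccati (fun s => differential F (P s t0) (Q s t0) (v s t0))
    (fun s => hess F (P s t0) (Q s t0) (v s t0) (v s t0) +
       differential F (P s t0) (Q s t0) (u s t0)) (/ (2 * theta)) (/ 8)).
  - apply Rinv_0_lt_compat. lra.
  - lra.
  - intros s. destruct (Hhor s) as [G1 [G2 [G3 G4]]]. destruct (HQ s t0) as [Q1 Q2].
    evar_last.
    + apply (is_derive_differential F (fun s => P s t0) (fun s => Q s t0)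
        (fun s => - B s t0) (fun s => A s t0)); eauto.
    + fold (v s t0). unfold differential, u, pair_vec. simpl. field. lra.
  (* From hv >= 1/4 and dF(u) >= - 1/8 the derivative is at least hv/2, while the barrier bound
     gives hv >= dF(v)^2 / theta. *)
  - intros s. destruct (Hray s t0 Ht0) as [Hg _]. specialize (Hlow s).
    assert (Hb := barrier_differential theta D F _ _ (v s t0) (Rlt_le _ _ Hth) HB
      (HD s t0 Ht0) (proj1 (HQ s t0)) (Hv s t0)).
    set (hv := hess F _ _ _ _) in *.
    apply Rmult_le_reg_l with (2 * theta); [lra|].
    rewrite <- Rmult_assoc, Rinv_r, Rmult_1_l by lra. nra.
  - intros s. destruct (Hray s t0 Ht0) as [Hg _]. specialize (Hlow s). lra.
Qed.

(** * Horospherical charts *)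

(* Isometric involutions of the half-plane, used as charts that move the centre
   of a horoball to infinity; [Inversion c] is the inversion in the unit circle
   centred at the boundary point [c]. *)
Inductive chart : Set := Identity | Inversion (c : R).

Definition chart_x (k : chart) (x y : R) : R :=
  match k with
  | Identity => x
  | Inversion c => c + (x - c) / ((x - c) ^ 2 + y ^ 2)
  end.

Definition chart_y (k : chart) (x y : R) : R :=
  match k with
  | Identity => y
  | Inversion c => y / ((x - c) ^ 2 + y ^ 2)
  end.

Lemma norm2_pos (x y : R) : 0 < y -> 0 < x ^ 2 + y ^ 2.
Proof. intros Hy. pose proof (pow2_ge_0 x). nra. Qed.

Lemma chart_y_pos (k : chart) (x y : R) : 0 < y -> 0 < chart_y k x y.
Proof.
  intros Hy. destruct k as [|c]; [exact Hy|].
  apply Rdiv_lt_0_compat; [exact Hy|now apply norm2_pos].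
Qed.

Lemma chart_involutive (k : chart) (x y : R) : 0 < y ->
  chart_x k (chart_x k x y) (chart_y k x y) = x /\
  chart_y k (chart_x k x y) (chart_y k x y) = y.
Proof.
  intros Hy. destruct k as [|c]; [easy|]. unfold chart_x, chart_y.
  assert (HN := norm2_pos (x - c) y Hy).
  set (N := (x - c) ^ 2 + y ^ 2) in *.
  (* Inversion sends the squared Euclidean distance to [c] to its reciprocal. *)
  assert (E : (c + (x - c) / N - c) ^ 2 + (y / N) ^ 2 = / N).
  { transitivity (((x - c) ^ 2 + y ^ 2) / N ^ 2); [field; lra|].
    fold N. field. lra. }
  rewrite E. split; field; lra.
Qed.

(** For [Inversion c] and positive [h], this is the Euclidean disc tangent to the boundary at
    [c]. *)
Definition half_plane_above (k : chart) (h x y : R) : Prop :=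
  0 < y /\ h < chart_y k x y.

Lemma half_plane_above_open (k : chart) (h x y : R) :
  half_plane_above k h x y -> locally_2d (half_plane_above k h) x y.
Proof.
  intros [Hy Hh]. apply locally_2d_and; [now apply locally_2d_pos|].
  assert (Hc : continuity_2d_pt (chart_y k) x y).
  { destruct k as [|c]; simpl.
    - apply continuity_2d_pt_id2.
    - assert (HN := norm2_pos (x - c) y Hy).
      apply (continuity_2d_pt_mult (fun _ v => v) (fun u v => / ((u - c) ^ 2 + v ^ 2))).
      + apply continuity_2d_pt_id2.
      + apply (continuity_2d_pt_inv (fun u v => (u - c) ^ 2 + v ^ 2)); [|simpl in *; lra].
        apply (continuity_2d_pt_plus (fun u _ => (u - c) ^ 2) (fun _ v => v ^ 2)).
        * apply (continuity_1d_2d_pt_comp (fun z => (z - c) ^ 2) (fun u _ => u)).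
          -- apply continuity_pt_filterlim, (ex_derive_continuous (fun z => (z - c) ^ 2)).
             now auto_derive.
          -- apply continuity_2d_pt_id1.
        * apply (continuity_1d_2d_pt_comp (fun z => z ^ 2) (fun _ v => v)).
          -- apply continuity_pt_filterlim, (ex_derive_continuous (fun z => z ^ 2)).
             now auto_derive.
          -- apply continuity_2d_pt_id2. }
  assert (He : 0 < chart_y k x y - h) by lra.
  destruct (Hc (mkposreal _ He)) as [d Hd]. exists d. intros u v Hu Hv.
  specialize (Hd u v Hu Hv). simpl in Hd. apply Rabs_def2 in Hd. lra.
Qed.

(** In the chart the rays are vertical, at height [h * exp t]; the factor [m], the height at [t0],
    makes [s] arc length on that horocycle. For [Inversion c] the formulas are the images of such
    lines. *)
Lemma horocyclic_coords_above (k : chart) (h t0 : R) : 0 < h ->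
  exists P Q A B, horocyclic_coords t0 P Q A B /\
    forall s t, 0 < t -> half_plane_above k h (P s t) (Q s t).
Proof.
  intros Hh. set (m := h * exp t0).
  assert (Hm : 0 < m) by (pose proof (exp_pos t0); unfold m; nra).
  assert (HE : forall t, 0 < h * exp t) by (intros t; pose proof (exp_pos t); nra).
  assert (Hgt : forall t, 0 < t -> h < h * exp t).
  { intros t Ht. assert (1 < exp t) by (rewrite <- exp_0; now apply exp_increasing). nra. }
  destruct k as [|c].
  (* The sign gives the direction [(- B, A)]; inversion reverses orientation, so the other case has
     none. *)
  - exists (fun s _ => - (s * m)), (fun _ t => h * exp t), (fun _ _ => 0), (fun _ t => h * exp t).
    split; [split; [|split]|].
    + intros s t. split; [apply HE|ring].
    + intros s t. specialize (HE t). cbv beta.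
      split; [|split; [|split]]; auto_derive; trivial; try ring; field;
        (split; [apply Rgt_not_eq, exp_pos|lra]).
    + intros s. fold m. cbv beta. 
      split; [|split; [|split]]; auto_derive; trivial; try ring; field; lra.
    + intros s t Ht. split; [apply HE|apply Hgt, Ht].
  - set (x := fun s : R => s * m). set (y := fun t => h * exp t).
    set (N := fun s t => x s ^ 2 + y t ^ 2).
    assert (HN : forall s t, 0 < N s t) by (intros; apply norm2_pos, HE).
    exists (fun s t => c + x s / N s t), (fun s t => y t / N s t),
      (fun s t => - 2 * x s * y t ^ 2 / N s t ^ 2),
      (fun s t => y t * (x s ^ 2 - y t ^ 2) / N s t ^ 2).
    assert (Hy : forall t, is_derive y t (y t))
      by (intros t; unfold y; auto_derive; trivial; ring).
    assert (Hx : forall s, is_derive x s m)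
      by (intros s; unfold x; auto_derive; trivial; ring).
    assert (Hy0 : y t0 = m) by reflexivity.
    split; [split; [|split]|].
    + intros s t. specialize (HN s t). split; [apply Rdiv_lt_0_compat; [apply HE|exact HN]|].
      unfold N in *. field. lra.
    + intros s t. specialize (HN s t). unfold N in *. specialize (HE t). fold (y t) in HE.
      specialize (Hy t).
      cbv beta; split; [|split; [|split]]; (auto_derive;
        [repeat split; try (now exists (y t)); simpl in *; nra
        |replace (Derive _ t) with (y t) by (symmetry; apply is_derive_unique, Hy); field; repeat split; lra]).
    + intros s. specialize (HN s t0). unfold N in *. rewrite Hy0 in *.
      specialize (Hx s).
      cbv beta; split; [|split; [|split]]; (auto_derive;
        [repeat split; try (now exists m); simpl in *; nra
        |replace (Derive _ s) with m by (symmetry; apply is_derive_unique, Hx); field; repeat split; lra]).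
    + intros s t Ht. specialize (HN s t). split; [apply Rdiv_lt_0_compat; [apply HE|exact HN]|].
      unfold chart_y.
      replace ((c + x s / N s t - c) ^ 2 + (y t / N s t) ^ 2) with (/ N s t).
      * replace (y t / N s t / / N s t) with (y t) by (field; lra). apply Hgt, Ht.
      * transitivity ((x s ^ 2 + y t ^ 2) / N s t ^ 2); [fold (N s t); field; lra|field; lra].
Qed.

(** * Distance and Busemann functions *)

Lemma speed_eq (c : curve) (t : R) :
  speed c t = sqrt ((Derive (c X) t ^ 2 + Derive (c Y) t ^ 2) * / c Y t ^ 2).
Proof.
  unfold speed, inner, sum2, velocity, metric. f_equal. ring.
Qed.

(** An admissible path and a lower bound make the infimum finite, so [real] returns it and not a
    default value. *)
Lemma dist_bounds (x1 y1 x2 y2 l : R) (c0 : curve) :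
  C1_path c0 x1 y1 x2 y2 ->
  (forall c, C1_path c x1 y1 x2 y2 -> l <= RInt (speed c) 0 1) ->
  l <= Defs.dist x1 y1 x2 y2 <= RInt (speed c0) 0 1.
Proof.
  intros Hc0 Hl. unfold Defs.dist.
  set (E := fun L : R => exists c, C1_path c x1 y1 x2 y2 /\ L = RInt (speed c) 0 1).
  destruct (Glb_Rbar_correct E) as [Hlb Hglb].
  assert (H1 : Rbar_le (Glb_Rbar E) (RInt (speed c0) 0 1)) by (apply Hlb; now exists c0).
  assert (H2 : Rbar_le l (Glb_Rbar E)).
  { apply Hglb. intros L [c [Hc ->]]. now apply Hl. }
  destruct (Glb_Rbar E); [split; assumption|destruct H1|destruct H2].
Qed.

(** A calibration: the covector [(al, be)] has dual norm at most 1, so [f] grows no faster than arc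
    length. *)
Lemma C1_path_length_ge (c : curve) (x1 y1 x2 y2 : R) (f al be : R -> R) :
  C1_path c x1 y1 x2 y2 ->
  (forall t, 0 <= t <= 1 ->
     is_derive f t (al t * Derive (c X) t + be t * Derive (c Y) t)) ->
  (forall t, 0 <= t <= 1 -> continuous al t /\ continuous be t) ->
  (forall t, 0 <= t <= 1 -> (al t ^ 2 + be t ^ 2) * c Y t ^ 2 <= 1) ->
  f 1 - f 0 <= RInt (speed c) 0 1.
Proof.
  intros [Hc _] Hf Hcont Hle.
  set (g := fun t => al t * Derive (c X) t + be t * Derive (c Y) t).
  assert (Hg : is_RInt g 0 1 (f 1 - f 0)).
  { apply (is_RInt_derive f g); rewrite Rmin_left, Rmax_right by lra; intros t Ht.
    - now apply Hf.
    - destruct (Hcont t Ht) as [Ha Hb]. destruct (Hc t Ht) as [_ Hi].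
      apply (continuous_plus (fun t => al t * Derive (c X) t) (fun t => be t * Derive (c Y) t)).
      + apply (continuous_mult al (Derive (c X))); [exact Ha|apply Hi].
      + apply (continuous_mult be (Derive (c Y))); [exact Hb|apply Hi]. }
  rewrite <- (is_RInt_unique _ _ _ _ Hg).
  apply RInt_le; [lra|now exists (f 1 - f 0)| |].
  - apply (ex_RInt_continuous (V := R_CompleteNormedModule)).
    rewrite Rmin_left, Rmax_right by lra. intros t Ht.
    destruct (Hc t Ht) as [Hpos Hi]. unfold in_H2 in Hpos.
    eapply continuous_ext; [intros s; symmetry; apply speed_eq|].
    apply (continuous_comp (fun s => (Derive (c X) s ^ 2 + Derive (c Y) s ^ 2) * / c Y s ^ 2) sqrt);
      [|apply continuous_sqrt].
    assert (Hsq : forall i, continuous (fun s => Derive (c i) s ^ 2) t).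
    { intros i. apply (continuous_comp (Derive (c i)) (fun z => z ^ 2)); [apply Hi|].
      apply (ex_derive_continuous (fun z => z ^ 2)). now auto_derive. }
    apply (continuous_mult (fun s => Derive (c X) s ^ 2 + Derive (c Y) s ^ 2)
      (fun s => / c Y s ^ 2)).
    + apply (continuous_plus (fun s => Derive (c X) s ^ 2)); apply Hsq.
    + apply (ex_derive_continuous (fun s => / c Y s ^ 2)).
      destruct (Hi Y) as [HY _]. auto_derive. split; [exact HY|split; [nra|easy]].
  - intros t Ht. assert (Ht' : 0 <= t <= 1) by lra.
    destruct (Hc t Ht') as [Hpos _]. unfold in_H2 in Hpos. specialize (Hle t Ht').
    rewrite speed_eq. unfold g.
    set (u := Derive (c X) t). set (v := Derive (c Y) t). set (y := c Y t) in *.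
    apply Rle_trans with (1 := Rle_abs _). rewrite <- sqrt_Rsqr_abs.
    apply sqrt_le_1_alt. unfold Rsqr.
    apply Rle_trans with ((al t ^ 2 + be t ^ 2) * (u ^ 2 + v ^ 2)).
    (* Cauchy-Schwarz, from Lagrange's identity. *)
    + pose proof (pow2_ge_0 (al t * v - be t * u)). nra.
    + rewrite (Rmult_comm (u ^ 2 + v ^ 2)). apply Rmult_le_compat_r; [nra|].
      apply Rmult_le_reg_r with (y ^ 2); [nra|]. rewrite Rinv_l by nra. exact Hle.
Qed.

(* [ln (chart_y k x y)] is 1-Lipschitz: its gradient has norm 1. *)
Lemma C1_path_length_ge_ln (k : chart) (c : curve) (x1 y1 x2 y2 : R) :
  C1_path c x1 y1 x2 y2 ->
  ln (chart_y k x1 y1) - ln (chart_y k x2 y2) <= RInt (speed c) 0 1.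
Proof.
  intros Hc. assert (Hc' := Hc). destruct Hc' as [Hreg [[E1 E2] [E3 E4]]].
  set (f := fun t => - ln (chart_y k (c X t) (c Y t))).
  replace (ln (chart_y k x1 y1) - ln (chart_y k x2 y2)) with (f 1 - f 0)
    by (unfold f; rewrite E1, E2, E3, E4; ring).
  destruct k as [|a]; unfold chart_y in f.
  - apply C1_path_length_ge with (1 := Hc) (al := fun _ => 0) (be := fun t => - / c Y t);
      intros t Ht; destruct (Hreg t Ht) as [Hpos Hi]; unfold in_H2 in Hpos;
      destruct (Hi Y) as [HY _].
    + unfold f. auto_derive; [easy|]. change (Derive (fun x => c Y x) t) with (Derive (c Y) t). ring.
    + split; [apply continuous_const|].
      apply (ex_derive_continuous (fun t => - / c Y t)). auto_derive. split; [exact HY|lra].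
    + right. field. lra.
  - set (N := fun t => (c X t - a) ^ 2 + c Y t ^ 2).
    apply C1_path_length_ge with (1 := Hc)
      (al := fun t => 2 * (c X t - a) / N t)
      (be := fun t => (c Y t ^ 2 - (c X t - a) ^ 2) / (N t * c Y t));
      intros t Ht; destruct (Hreg t Ht) as [Hpos Hi]; unfold in_H2 in Hpos;
      destruct (Hi Y) as [HY _]; destruct (Hi X) as [HX _];
      assert (HN := norm2_pos (c X t - a) (c Y t) Hpos).
    + unfold f. auto_derive.
      * repeat split; trivial; [simpl in *; lra|].
        apply Rdiv_lt_0_compat; [exact Hpos|simpl in *; lra].
      * change (Derive (fun x => c Y x) t) with (Derive (c Y) t).
        change (Derive (fun x => c X x) t) with (Derive (c X) t).
        unfold N. field. split; lra.
    + split.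
      * apply (ex_derive_continuous (fun t => 2 * (c X t - a) / N t)). unfold N.
        auto_derive. repeat split; trivial. simpl in *; lra.
      * apply (ex_derive_continuous (fun t => (c Y t ^ 2 - (c X t - a) ^ 2) / (N t * c Y t))).
        unfold N. auto_derive. repeat split; trivial. apply Rmult_integral_contrapositive.
        simpl in *; lra.
    + right. unfold N. field. split; lra.
Qed.

(** [C1_path] asks for two-sided derivatives at the end points; positivity of [p] extends past
    them. *)
Lemma C1_of_derivative_on (f g p : R -> R) (t : R) :
  continuous p t -> 0 < p t ->
  (forall u, 0 < p u -> is_derive f u (g u)) -> ex_derive g t ->
  ex_derive f t /\ continuous (Derive f) t.
Proof.
  intros Hp Ht Hf Hg. split; [exists (g t); now apply Hf|].
  apply (continuous_ext_loc (Derive f) g).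
  - assert (Hloc : locally t (fun u => 0 < p u)) by exact (Hp _ (open_gt 0 _ Ht)).
    revert Hloc. apply filter_imp. intros u Hu. symmetry. now apply is_derive_unique, Hf.
  - now apply (ex_derive_continuous g).
Qed.

(** In general not a geodesic, but its excess length vanishes as one end rises vertically to
    infinity in the chart, which suffices for the Busemann limit. *)
Definition segment_image (k : chart) (x1 y1 x2 y2 : R) : curve := fun i t =>
  let x := x1 + t * (x2 - x1) in let y := y1 + t * (y2 - y1) in
  match i with X => chart_x k x y | Y => chart_y k x y end.

(** Charts are isometries, so the speed is that of the straight segment itself. *)
Lemma segment_image_C1 (k : chart) (x1 y1 x2 y2 : R) : 0 < y1 -> 0 < y2 ->
  C1_path (segment_image k x1 y1 x2 y2) (chart_x k x1 y1) (chart_y k x1 y1)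
    (chart_x k x2 y2) (chart_y k x2 y2) /\
  forall t, 0 <= t <= 1 ->
    speed (segment_image k x1 y1 x2 y2) t =
    sqrt ((x2 - x1) ^ 2 + (y2 - y1) ^ 2) * / (y1 + t * (y2 - y1)).
Proof.
  intros H1 H2. set (c := segment_image k x1 y1 x2 y2).
  set (p := fun t => y1 + t * (y2 - y1)). set (q := fun t => x1 + t * (x2 - x1)).
  assert (Hp : forall t, 0 <= t <= 1 -> 0 < p t) by (unfold p; intros; nra).
  assert (Hpc : forall t, continuous p t)
    by (intros t; apply (ex_derive_continuous p); unfold p; auto_derive; easy).
  assert (H : exists g : axis -> R -> R,
    (forall i t, 0 < p t -> is_derive (c i) t (g i t) /\ ex_derive (g i) t) /\
    forall t, 0 < p t -> (g X t ^ 2 + g Y t ^ 2) * / c Y t ^ 2 =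
      ((x2 - x1) ^ 2 + (y2 - y1) ^ 2) * / p t ^ 2).
  { destruct k as [|a].
    - exists (fun i _ => match i with X => x2 - x1 | Y => y2 - y1 end). split; [|easy].
      intros i t Ht. destruct i; unfold c, segment_image, chart_x, chart_y;
        (split; [auto_derive; trivial; ring|apply ex_derive_const]).
    - set (N := fun t => (q t - a) ^ 2 + p t ^ 2).
      set (u := x2 - x1). set (v := y2 - y1).
      (* The differential of the inversion applied to [(u, v)]. *)
      exists (fun i t => match i with
        | X => ((p t ^ 2 - (q t - a) ^ 2) * u - 2 * (q t - a) * p t * v) / N t ^ 2
        | Y => (((q t - a) ^ 2 - p t ^ 2) * v - 2 * (q t - a) * p t * u) / N t ^ 2 end).
      assert (HN : forall t, 0 < p t -> 0 < N t) by (intros; now apply norm2_pos).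
      split.
      + intros i t Ht. specialize (HN t Ht). unfold N, p, q in *. fold u v in HN |- *.
        split.
        * destruct i; unfold c, segment_image, chart_x, chart_y; fold u v; auto_derive;
            [simpl in *; repeat split; lra|field; lra|simpl in *; repeat split; lra|field; lra].
        * destruct i; auto_derive; repeat split; simpl in *; nra.
      + intros t Ht. specialize (HN t Ht).
        change (c Y t) with (p t / N t). unfold N in *. field. lra. }
  destruct H as [g [Hg Hsp]]. split; [split; [|split]|].
  - intros t Ht. specialize (Hp t Ht). split.
    + unfold in_H2, c, segment_image. apply chart_y_pos, Hp.
    + intros i. apply (C1_of_derivative_on (c i) (g i) p); auto.
      * intros u Hu. now apply Hg.
      * now apply Hg.
  - unfold c, segment_image. split; f_equal; ring.
  - unfold c, segment_image. split; f_equal; ring.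
  - intros t Ht. specialize (Hp t Ht). rewrite speed_eq.
    rewrite (is_derive_unique _ _ _ (proj1 (Hg X t Hp))),
      (is_derive_unique _ _ _ (proj1 (Hg Y t Hp))), Hsp by exact Hp.
    rewrite sqrt_mult_alt by (pose proof (pow2_ge_0 (x2 - x1)); pose proof (pow2_ge_0 (y2 - y1)); lra).
    f_equal. rewrite <- pow_inv, sqrt_pow2; [reflexivity|].
    apply Rlt_le, Rinv_0_lt_compat, Hp.
Qed.

(** Below, the logarithm of the chart height is 1-Lipschitz. Above, the segment has length sqrt(1 +
    e) (ln y1 - ln y2) with e = ((x1 - x2)/(y1 - y2))^2; the error term comes from sqrt(1 + e) <= 1
    + e and ln y1 - ln y2 <= (y1 - y2)/y2. *)
Lemma dist_chart_bounds (k : chart) (x1 y1 x2 y2 : R) : 0 < y2 -> y2 < y1 ->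
  ln y1 - ln y2 <=
    Defs.dist (chart_x k x1 y1) (chart_y k x1 y1) (chart_x k x2 y2) (chart_y k x2 y2) <=
    ln y1 - ln y2 + (x1 - x2) ^ 2 / (y2 * (y1 - y2)).
Proof.
  intros H2 H12. assert (H1 : 0 < y1) by lra.
  destruct (segment_image_C1 k x1 y1 x2 y2 H1 H2) as [HC Hsp].
  destruct (dist_bounds _ _ _ _ (ln y1 - ln y2) _ HC) as [Hlow Hup].
  { intros c Hc. generalize (C1_path_length_ge_ln k c _ _ _ _ Hc).
    now rewrite (proj2 (chart_involutive k x1 y1 H1)), (proj2 (chart_involutive k x2 y2 H2)). }
  split; [exact Hlow|]. eapply Rle_trans; [exact Hup|].
  set (L := sqrt ((x2 - x1) ^ 2 + (y2 - y1) ^ 2)) in *.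
  assert (Hint : is_RInt (fun t => L * / (y1 + t * (y2 - y1))) 0 1
    (L / (y1 - y2) * (ln y1 - ln y2))).
  { set (G := fun t => - (L / (y1 - y2)) * ln (y1 + t * (y2 - y1))).
    replace (L / (y1 - y2) * (ln y1 - ln y2)) with (G 1 - G 0).
    - apply (is_RInt_derive G); rewrite Rmin_left, Rmax_right by lra; intros t Ht.
      + unfold G. auto_derive; [nra|field; split; [nra|lra]].
      + apply (ex_derive_continuous (fun t => L * / (y1 + t * (y2 - y1)))).
        auto_derive. nra.
    - unfold G. replace (y1 + 1 * (y2 - y1)) with y2 by ring.
      replace (y1 + 0 * (y2 - y1)) with y1 by ring. ring. }
  rewrite (RInt_ext _ (fun t => L * / (y1 + t * (y2 - y1)))).
  2:{ rewrite Rmin_left, Rmax_right by lra. intros t Ht. apply Hsp. lra. }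
  rewrite (is_RInt_unique _ _ _ _ Hint).
  set (d := y1 - y2) in *. assert (Hd : 0 < d) by (unfold d; lra).
  set (e := (x1 - x2) ^ 2 / d ^ 2).
  assert (He : 0 <= e) by (apply Rdiv_le_0_compat; [apply pow2_ge_0|nra]).
  assert (HL : L / d <= 1 + e).
  { apply Rmult_le_reg_r with d; [exact Hd|].
    replace (L / d * d) with L by (field; lra).
    rewrite <- (sqrt_pow2 ((1 + e) * d)) by nra. apply sqrt_le_1_alt.
    assert (e * d ^ 2 = (x1 - x2) ^ 2) by (unfold e; field; lra).
    replace ((y2 - y1) ^ 2) with (d ^ 2) by (unfold d; ring). nra. }
  assert (Hln : 0 <= ln y1 - ln y2 <= d / y2).
  { split.
    - assert (ln y2 < ln y1) by (apply ln_increasing; assumption). lra.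
    - rewrite <- ln_div by assumption.
      assert (E : y1 / y2 = 1 + d / y2) by (unfold d; field; lra).
      assert (0 < d / y2) by (apply Rdiv_lt_0_compat; assumption).
      rewrite <- (ln_exp (d / y2)). apply ln_le; [rewrite E; lra|].
      rewrite E. apply exp_ineq1_le. }
  assert ((x1 - x2) ^ 2 / (y2 * d) = e * (d / y2)) by (unfold e; field; lra).
  nra.
Qed.

(** At height Z = h exp t one has ln Z - t = ln h, and the distance bounds leave an error of order
    1/Z. *)
Lemma is_busemann_chart (k : chart) (c : curve) (a h x y : R) : 0 < h -> 0 < y ->
  (forall t, 0 <= t -> c X t = chart_x k a (h * exp t) /\ c Y t = chart_y k a (h * exp t)) ->
  is_busemann c (chart_x k x y) (chart_y k x y) (ln h - ln y).
Proof.
  intros Hh Hy Hc. apply is_lim_spec. intros eps. simpl.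
  set (K := (a - x) ^ 2). assert (HK : 0 <= K) by apply pow2_ge_0.
  pose proof (cond_pos eps) as He.
  assert (Hq : 0 <= K / (y * eps)) by (apply Rdiv_le_0_compat; nra).
  (* Past this time Z - y exceeds [K / (y * eps)], because exp t >= 1 + t. *)
  exists ((y + K / (y * eps)) / h). intros t Ht.
  assert (Ht0 : 0 < t).
  { eapply Rle_lt_trans; [|exact Ht]. apply Rdiv_le_0_compat; lra. }
  apply (Rmult_lt_compat_r h) in Ht; [|exact Hh].
  unfold Rdiv at 1 in Ht. rewrite Rmult_assoc, Rinv_l, Rmult_1_r in Ht by lra.
  pose proof (exp_ineq1_le t) as Hexp.
  set (Z := h * exp t) in *. assert (HZ : h + t * h <= Z) by (unfold Z; nra).
  destruct (Hc t) as [-> ->]; [lra|].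
  destruct (dist_chart_bounds k a Z x y) as [B1 B2]; [exact Hy|lra|].
  assert (El : ln Z = ln h + t)
    by (unfold Z; rewrite ln_mult, ln_exp; [reflexivity|exact Hh|apply exp_pos]).
  fold K in B2.
  assert (Hsmall : K / (y * (Z - y)) < eps).
  { assert (0 < y * (Z - y)) by (apply Rmult_lt_0_compat; lra).
    apply Rmult_lt_reg_r with (y * (Z - y)); [assumption|].
    replace (K / (y * (Z - y)) * (y * (Z - y))) with K by (field; lra).
    replace K with (K / (y * eps) * (y * eps)) by (field; lra).
    replace (eps * (y * (Z - y))) with ((Z - y) * (y * eps)) by ring.
    apply Rmult_lt_compat_r; [nra|]. lra. }
  fold Z. apply Rabs_def1; lra.
Qed.

(** * Geodesic rays *)

Lemma constant_on_ray (f : R -> R) :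
  (forall t, 0 <= t -> is_derive f t 0) -> forall t, 0 <= t -> f t = f 0.
Proof.
  intros Hf t [Ht| <-]; [|reflexivity]. symmetry.
  apply eq_is_derive; [|exact Ht]. intros s Hs. now apply Hf.
Qed.

Lemma geodesic_ray_ode (c : curve) (t : R) : geodesic_ray c -> 0 <= t ->
  let a := Derive (c X) in let b := Derive (c Y) in
  0 < c Y t /\ a t ^ 2 + b t ^ 2 = c Y t ^ 2 /\
  is_derive (c X) t (a t) /\ is_derive (c Y) t (b t) /\
  is_derive a t (2 * a t * b t / c Y t) /\
  is_derive b t ((b t ^ 2 - a t ^ 2) / c Y t).
Proof.
  intros Hc Ht a b. destruct (Hc t Ht) as [Hq [Hreg [Hgeo Hsp]]].
  unfold in_H2 in Hq.
  assert (HX := Hgeo X). assert (HY := Hgeo Y).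
  unfold sum2, velocity in HX, HY. rewrite !christoffel_eq in HX, HY by exact Hq.
  change (Derive_n (c X) 2 t) with (Derive a t) in HX.
  change (Derive_n (c Y) 2 t) with (Derive b t) in HY.
  fold a b in HX, HY.
  split; [exact Hq|split; [|split; [|split; [|split]]]].
  - rewrite speed_eq in Hsp. fold a b in Hsp.
    assert (Hn : 0 <= (a t ^ 2 + b t ^ 2) * / c Y t ^ 2).
    { apply Rmult_le_pos; [nra|]. apply Rlt_le, Rinv_0_lt_compat. nra. }
    apply (f_equal (fun z => z ^ 2)) in Hsp. rewrite pow2_sqrt in Hsp by exact Hn.
    replace (a t ^ 2 + b t ^ 2) with ((a t ^ 2 + b t ^ 2) * / c Y t ^ 2 * c Y t ^ 2)
      by (field; lra).
    rewrite Hsp. ring.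
  - apply Derive_correct, (Hreg X).
  - apply Derive_correct, (Hreg Y).
  - replace (2 * a t * b t / c Y t) with (Derive a t)
      by (apply Rminus_diag_uniq; rewrite <- HX; field; lra).
    apply Derive_correct, (Hreg X).
  - replace ((b t ^ 2 - a t ^ 2) / c Y t) with (Derive b t)
      by (apply Rminus_diag_uniq; rewrite <- HY; field; lra).
    apply Derive_correct, (Hreg Y).
Qed.

(* With [w = c_Y' / c_Y], the quantities [c_X' / c_Y^2] and, when [w <> 1]
   everywhere, the end point [c_X + c_X' / (1 - w)] are conserved; [w = 1] at
   some time forces a vertical ray. *)
Lemma geodesic_ray_chart (c : curve) : geodesic_ray c ->
  exists k a0 h, 0 < h /\ forall t, 0 <= t ->
    c X t = chart_x k a0 (h * exp t) /\ c Y t = chart_y k a0 (h * exp t).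
Proof.
  intros Hc.
  set (p := c X). set (q := c Y). set (a := Derive p). set (b := Derive q).
  assert (Hode : forall t, 0 <= t -> 0 < q t /\ a t ^ 2 + b t ^ 2 = q t ^ 2 /\
    is_derive p t (a t) /\ is_derive q t (b t) /\
    is_derive a t (2 * a t * b t / q t) /\ is_derive b t ((b t ^ 2 - a t ^ 2) / q t))
    by (intros; now apply geodesic_ray_ode).
  clearbody p q a b. clear Hc c.
  assert (Hka : forall t, 0 <= t -> a t / q t ^ 2 = a 0 / q 0 ^ 2).
  { apply (constant_on_ray (fun t => a t / q t ^ 2)). intros t Ht.
    destruct (Hode t Ht) as [Hq [Hs [Dp [Dq [Da Db]]]]]. evar_last.
    - apply (is_derive_quot a (fun t => q t ^ 2)); [nra|exact Da|].
      apply (is_derive_pow q 2 t _ Dq).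
    - simpl. field. lra. }
  (* The first case is the ascending vertical ray; descending vertical rays fall in the second. *)
  destruct (classic (exists t, 0 <= t /\ b t = q t)) as [[t1 [Ht1 Eb]]|Hne].
  (* Unit speed forces [a t1 = 0], and conservation of [a / q ^ 2] spreads this to all times. *)
  - assert (Ha : forall t, 0 <= t -> a t = 0).
    { intros t Ht. destruct (Hode t1 Ht1) as [Hq1 [Hs1 _]].
      destruct (Hode t Ht) as [Hq _].
      assert (a t1 = 0) by (rewrite Eb in Hs1; nra).
      assert (E : a t / q t ^ 2 = 0)
        by (rewrite Hka by exact Ht; rewrite <- (Hka t1 Ht1), H; field; lra).
      replace (a t) with (a t / q t ^ 2 * q t ^ 2) by (field; lra).
      rewrite E. ring. }
    assert (Hw : forall t, 0 <= t -> b t / q t = b 0 / q 0).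
    { apply (constant_on_ray (fun t => b t / q t)). intros t Ht.
      destruct (Hode t Ht) as [Hq [Hs [Dp [Dq [Da Db]]]]]. evar_last.
      - apply (is_derive_quot b q); [lra|exact Db|exact Dq].
      - rewrite (Ha t Ht). field. lra. }
    assert (Hb : forall t, 0 <= t -> b t = q t).
    { intros t Ht. destruct (Hode t1 Ht1) as [Hq1 _]. destruct (Hode t Ht) as [Hq _].
      assert (E : b t / q t = 1)
        by (rewrite Hw by exact Ht; rewrite <- (Hw t1 Ht1), Eb; field; lra).
      replace (b t) with (b t / q t * q t) by (field; lra). rewrite E. ring. }
    exists Identity, (p 0), (q 0). split; [apply Hode; lra|]. intros t Ht. simpl. split.
    + apply (constant_on_ray p); [|exact Ht]. intros s Hs.
      rewrite <- (Ha s Hs). now apply Hode.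
    + assert (E : q t * exp (- t) = q 0 * exp (- 0)).
      { apply (constant_on_ray (fun t => q t * exp (- t))); [|exact Ht]. intros s Hs.
        destruct (Hode s Hs) as [_ [_ [_ [Dq _]]]]. auto_derive; [now exists (b s)|].
        replace (Derive _ s) with (b s) by (symmetry; apply is_derive_unique, Dq).
        rewrite (Hb s Hs). ring. }
      rewrite Ropp_0, exp_0, Rmult_1_r in E. rewrite <- E, Rmult_assoc, <- exp_plus.
      rewrite Rplus_opp_l, exp_0. ring.
  - assert (Hlt : forall t, 0 <= t -> 0 < q t - b t).
    { intros t Ht. destruct (Hode t Ht) as [Hq [Hs _]].
      assert (b t <> q t) by (intros E; apply Hne; now exists t).
      destruct (Rlt_le_dec (b t) (q t)); [lra|]. pose proof (pow2_ge_0 (a t)). nra. }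
    set (xi := p 0 + a 0 * q 0 / (q 0 - b 0)).
    assert (Hxi : forall t, 0 <= t -> p t + a t * q t / (q t - b t) = xi).
    { apply (constant_on_ray (fun t => p t + a t * q t / (q t - b t))). intros t Ht.
      specialize (Hlt t Ht).
      destruct (Hode t Ht) as [Hq [Hs [Dp [Dq [Da Db]]]]].
      auto_derive.
      - repeat split; [now exists (a t)|now eexists; apply Da|now exists (b t)|now exists (b t)|now eexists; apply Db|lra].
      - replace (Derive (fun x => p x) t) with (a t) by (symmetry; apply is_derive_unique, Dp).
        replace (Derive (fun x => q x) t) with (b t) by (symmetry; apply is_derive_unique, Dq).
        replace (Derive (fun x => a x) t) with (2 * a t * b t / q t) by (symmetry; apply is_derive_unique, Da).
        replace (Derive (fun x => b x) t) with ((b t ^ 2 - a t ^ 2) / q t) by (symmetry; apply is_derive_unique, Db).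
        replace (a t ^ 2) with (q t ^ 2 - b t ^ 2) by lra.
        field. lra. }
    assert (HN : forall t, 0 <= t ->
      (p t - xi) ^ 2 + q t ^ 2 = 2 * q t ^ 3 / (q t - b t)).
    { intros t Ht. specialize (Hlt t Ht). destruct (Hode t Ht) as [Hq [Hs _]].
      rewrite <- (Hxi t Ht).
      transitivity ((q t ^ 2 - b t ^ 2) * q t ^ 2 / (q t - b t) ^ 2 + q t ^ 2).
      - replace (q t ^ 2 - b t ^ 2) with (a t ^ 2) by lra. field. lra.
      - field. lra. }
    (* By [HN] the inverted height is (q - b)/(2 q^2); its exponential growth is stated here through
       the reciprocal. *)
    assert (Hbeta : forall t, 0 <= t ->
      q t ^ 2 / (q t - b t) * exp t = q 0 ^ 2 / (q 0 - b 0)).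
    { intros t Ht. rewrite (constant_on_ray (fun t => q t ^ 2 / (q t - b t) * exp t)).
      - rewrite exp_0. ring.
      - clear t Ht. intros t Ht. specialize (Hlt t Ht).
        destruct (Hode t Ht) as [Hq [Hs [Dp [Dq [Da Db]]]]].
        auto_derive.
        + repeat split; [now exists (b t)|now exists (b t)|now eexists; apply Db|lra].
        + replace (Derive (fun x => q x) t) with (b t) by (symmetry; apply is_derive_unique, Dq).
          replace (Derive (fun x => b x) t) with ((b t ^ 2 - a t ^ 2) / q t) by (symmetry; apply is_derive_unique, Db).
          replace (a t ^ 2) with (q t ^ 2 - b t ^ 2) by lra.
          field. lra.
      - exact Ht. }
    (* The inverted height at time 0. The abscissa given below is the inverted one, constant since
       [a / q ^ 2] is conserved. *)
    set (h := (q 0 - b 0) / (2 * q 0 ^ 2)).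
    assert (Hq0 : 0 < q 0) by (apply Hode; lra).
    assert (Hl0 : 0 < q 0 - b 0) by (apply Hlt; lra).
    exists (Inversion xi), (xi - a 0 / q 0 ^ 2 / 2), h.
    split; [apply Rdiv_lt_0_compat; nra|]. intros t Ht.
    destruct (Hode t Ht) as [Hq _]. assert (Hl := Hlt t Ht).
    assert (Ex : chart_x (Inversion xi) (p t) (q t) = xi - a 0 / q 0 ^ 2 / 2).
    { unfold chart_x. rewrite (HN t Ht), <- (Hka t Ht), <- (Hxi t Ht). field. lra. }
    assert (Ey : chart_y (Inversion xi) (p t) (q t) = h * exp t).
    { unfold chart_y. rewrite (HN t Ht).
      assert (Eh : h = / (2 * (q 0 ^ 2 / (q 0 - b 0)))) by (unfold h; field; lra).
      rewrite Eh, <- (Hbeta t Ht). field. pose proof (exp_pos t). lra. }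
    rewrite <- Ex, <- Ey.
    destruct (chart_involutive (Inversion xi) (p t) (q t) Hq) as [-> ->]. easy.
Qed.

Theorem corollary1p5 (D : R -> R -> Prop) (hD : open_horoball D)
  (theta : R) (htheta : 0 <= theta) :
  ~ exists F : R -> R -> R, barrier theta D F.
Proof.
  intros [F HF]. destruct hD as [c [Hc HD]].
  destruct (geodesic_ray_chart c Hc) as [k [a0 [h [Hh Hray]]]].
  (* Passing to [theta + 1] makes the constant positive, as the Riccati argument divides by it. *)
  assert (HB : barrier (theta + 1) D F).
  { destruct HF as [H1 [H2 H3]]. split; [exact H1|split; [exact H2|]].
    intros x y Hxy v Hv. apply Rle_trans with (sqrt theta); [now apply H3|].
    apply sqrt_le_1_alt. lra. }
  (* Chosen so that (theta + 1)/t0 = 1/8. *)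
  set (t0 := 8 * (theta + 1)).
  destruct (horocyclic_coords_above k h t0 Hh) as [P [Q [A [B [Hco HS]]]]].
  revert HB. apply (no_barrier_horocyclic_coords (theta + 1) t0 D
    (half_plane_above k h) F P Q A B); unfold t0; try lra; auto.
  - right. field. lra.
  - apply half_plane_above_open.
  (* The Busemann function is ln h minus the logarithm of the chart height, hence negative above
     height [h]. *)
  - intros x y [Hy Hxy]. apply HD. split; [exact Hy|].
    exists (ln h - ln (chart_y k x y)). split.
    + destruct (chart_involutive k x y Hy) as [E1 E2].
      generalize (is_busemann_chart k c a0 h (chart_x k x y) (chart_y k x y) Hh
        (chart_y_pos k x y Hy) Hray).
      now rewrite E1, E2.
    + assert (ln h < ln (chart_y k x y)) by now apply ln_increasing. lra.
Qed.
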